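(* Let $W$ be a Coxeter group with Bruhat order, let $n\ge 1$, and fix the data $I_k$ and $\varphi_{[x,y]}$ (for all $k<n$ and all intervals $[x,y]$ of length $k<n$) described in the context. Let $[u,v]$ and $[u',v']$ be Bruhat intervals of length $n$ in $W$, each equipped with an enumeration of its coatoms. If $TPA([u,v])=TPA([u',v'])$, then $[u,v]$ and $[u',v']$ are isomorphic as posets.
   Context: For $x\le y$ in $W$, the Bruhat interval $[x,y]=\{z\in W\mid x\le z\le y\}$ has length $\ell(y)-\ell(x)$, where $\ell$ is the Coxeter length; $x\lhd y$ means $x<y$ and $\ell(y)=\ell(x)+1$. Data: for each $k<n$, $I_k$ is a set of Bruhat intervals of length $k$ in $W$ containing exactly one representative of each poset-isomorphism class of such intervals, its elements enumerated by natural numbers; for every interval $[x,y]$ of length $k<n$ a poset isomorphism $\varphi_{[x,y]}$ from $[x,y]$ onto an element of $I_k$ is fixed. Construction for an interval $[u,v]$ of length $n$: enumerate its coatoms $\{w\in W\mid u<w\lhd v\}$ as $v_1,\dots,v_m$. Let $T([u,v])$ be the list $(t_1,\dots,t_m)$ where $t_i$ is the number of the element of $I_{n-1}$ isomorphic to $[u,v_i]$. For a tuple $\psi=(\psi_1,\dots,\psi_m)$ with $\psi_i$ a poset automorphism of $[u,v_i]$, put $\Theta_i=\varphi_{[u,v_i]}\circ\psi_i$. Set $P_\psi([u,v])=\{(i,j,\Theta_i(w),\Theta_j(w)) \mid 1\le i<j\le m,\ w\in[u,v],\ w\lhd v_i,\ w\lhd v_j\}$. For $w\in[u,v]$ with $w\lhd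 v_i$, there is exactly one other coatom $v_j$ ($j\neq i$) with $w\lhd v_j$; define $\tau^{\psi}_{(u,v),w}=\varphi_{[\Theta_i(u),\Theta_i(w)]}\circ\Theta_i|_{[u,w]}\circ\Theta_j^{-1}|_{\Theta_j([u,w])}\circ\varphi^{-1}_{[\Theta_j(u),\Theta_j(w)]}$, a poset automorphism of the element of $I_{n-2}$ isomorphic to $[u,w]$. Set $A_\psi([u,v])=\{(i,\Theta_i(w),\tau^{\psi}_{(u,v),w})\mid 1\le i\le m,\ w\in[u,v],\ w\lhd v_i\}$. Finally $TPA([u,v])=\{(T([u,v]),P_\psi([u,v]),A_\psi([u,v]))\mid \psi=(\psi_1,\dots,\psi_m),\ \psi_i\in\mathrm{Aut}([u,v_i])\}$; it depends on the chosen enumeration of coatoms. *)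

(* Defs.v *)
From HB Require Import structures.
From Stdlib Require Import Relation_Operators.
From mathcomp Require Import all_boot.
From mathcomp Require Import all_classical.

Set Implicit Arguments.
Unset Strict Implicit.
Unset Printing Implicit Defensive.

Local Open Scope classical_set_scope.
Local Open Scope group_scope.

Section Coxeter.
Variables (W : groupType) (S : set W).

Definition word_of (w : W) (l : seq W) : Prop :=
  (forall s, s \in l -> S s) /\ \big[*%g/1]_(s <- l) s = w.

(* (W, S) is a Coxeter system: W has the presentation                         *)
(* < S | (s t)^m(s,t) = 1 > for a Coxeter matrix m, where the value 0 of m    *)
(* stands for infinity. No finiteness of S is assumed. The last clause is the *)
(* universal property of the presentation; only the values of f on S matter.  *)
(* Inverses are not needed in words, since m(s,s) = 1 gives s^2 = 1.          *)
Definition coxeter_system : Prop :=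
  exists m : W -> W -> nat,
  [/\ forall s t, S s -> S t -> m s t = m t s /\ (m s t = 1%N <-> s = t),
      forall s t, S s -> S t -> (s * t) ^+ m s t = 1,
      forall w, exists l, word_of w l
    & forall (G : groupType) (f : W -> G),
        (forall s t, S s -> S t -> (f s * f t) ^+ m s t = 1) ->
        exists g : {multiplicative W -> G}, forall s, S s -> g s = f s].

Definition cox_length (w : W) : nat :=
  xget 0%N [set k | (exists2 l, word_of w l & size l = k) /\
                    (forall l, word_of w l -> (k <= size l)%N)].

Definition reflection (t : W) : Prop :=
  exists w s, S s /\ t = w * s * w^-1.

Definition bruhat_step (x y : W) : Prop :=
  exists t, [/\ reflection t, y = x * t & (cox_length x < cox_length y)%N].

Definition bruhat_le : W -> W -> Prop := clos_refl_trans W bruhat_step.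

Definition bruhat_lt (x y : W) : Prop := bruhat_le x y /\ x <> y.

Definition bruhat_cover (x y : W) : Prop :=
  bruhat_lt x y /\ cox_length y = (cox_length x).+1.

(* An interval [x, y] is encoded by the pair (x, y), which it determines when *)
(* x <= y; interval p is its underlying set.                                  *)
Definition interval (p : W * W) : set W :=
  [set z | bruhat_le p.1 z /\ bruhat_le z p.2].

Definition is_interval (k : nat) (p : W * W) : Prop :=
  bruhat_le p.1 p.2 /\ cox_length p.2 = (cox_length p.1 + k)%N.

(* Maps between intervals are total functions on W, of which only the         *)
(* restriction to the source interval is meaningful.                          *)
Definition poset_iso (p q : W * W) (f : W -> W) : Prop :=
  set_bij (interval p) (interval q) f /\
  forall x y, interval p x -> interval p y ->
    (bruhat_le x y <-> bruhat_le (f x) (f y)).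

Definition poset_isomorphic (p q : W * W) : Prop := exists f, poset_iso p q f.

(* reps k is I_k, number k is the numbering of its elements, and phi p is the *)
(* chosen isomorphism from p onto an element of I_k.                          *)
Record interval_data (n : nat) := IntervalData {
  reps : nat -> set (W * W);
  reps_interval : forall k p, (k < n)%N -> reps k p -> is_interval k p;
  reps_unique : forall k p, (k < n)%N -> is_interval k p ->
    exists! q, reps k q /\ poset_isomorphic p q;
  number : nat -> W * W -> nat;
  number_inj : forall k, (k < n)%N -> set_inj (reps k) (number k);
  phi : W * W -> W -> W;
  phi_iso : forall k p, (k < n)%N -> is_interval k p ->
    exists2 q, reps k q & poset_iso p q (phi p)
}.

Definition coatom_enum (p : W * W) (c : seq W) : Prop :=
  uniq c /\ forall w, w \in c <-> bruhat_lt p.1 w /\ bruhat_cover w p.2.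

Section TPA.
Variables (n : nat) (D : interval_data n).
(* The coatoms v_1, ..., v_m are listed in c, so indices run from 0 to m - 1. *)
Variables (u v : W) (c : seq W).

Definition coatom (i : nat) : W := nth u c i.

Definition rep_of (k : nat) (p : W * W) : W * W :=
  xget p [set q | reps D k q /\ poset_isomorphic p q].

Definition T_inv : seq nat :=
  [seq number D n.-1 (rep_of n.-1 (u, w)) | w <- c].

Section Psi.
Variable psi : nat -> W -> W.

Definition Theta (i : nat) : W -> W := phi D (u, coatom i) \o psi i.

Definition P_inv : set (nat * nat * W * W) :=
  [set q | exists i j w,
     [/\ (i < j < size c)%N, interval (u, v) w,
         bruhat_cover w (coatom i), bruhat_cover w (coatom j)
       & q = (i, j, Theta i w, Theta j w)]].

Definition Theta_interval (i : nat) (w : W) : W * W := (Theta i u, Theta i w).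

Definition tau_fun (i j : nat) (w : W) : W -> W :=
  phi D (Theta_interval i w) \o Theta i \o
  'pinv_id (interval (u, w)) (Theta j) \o
  'pinv_id (interval (Theta_interval j w)) (phi D (Theta_interval j w)).

(* tau as a set-theoretic function, i.e. the graph of tau_fun on its domain,  *)
(* the element of I_(n-2) onto which phi maps [Theta_j(u), Theta_j(w)].       *)
Definition tau (i j : nat) (w : W) : set (W * W) :=
  [set q | (phi D (Theta_interval j w) @` interval (Theta_interval j w)) q.1 /\
           q.2 = tau_fun i j w q.1].

(* In a Coxeter group, the index j below is determined by w and i.            *)
Definition A_inv : set (nat * W * set (W * W)) :=
  [set q | exists i j w,
     [/\ [/\ (i < size c)%N, (j < size c)%N & j <> i], interval (u, v) w,
         bruhat_cover w (coatom i), bruhat_cover w (coatom j)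
       & q = (i, Theta i w, tau i j w)]].

End Psi.

Definition TPA : set (seq nat * set (nat * nat * W * W) *
                      set (nat * W * set (W * W))) :=
  [set q | exists psi : nat -> W -> W,
     (forall i, (i < size c)%N ->
        poset_iso (u, coatom i) (u, coatom i) (psi i)) /\
     q = (T_inv, P_inv psi, A_inv psi)].

End TPA.
End Coxeter.

(* Main.v *)
(* Let Theta_i and Theta'_i be given by psi = id and by a psi' with the same  *)
(* triple (T, P, A). Then T gives the two maps a common target, so z goes to  *)
(* z' with Theta_i z = Theta'_i z' whenever z <= v_i. Independence of i holds *)
(* when z lies below some w covered by both v_i and v_j: P matches w with     *)
(* some w', and A matches the transition maps Theta_i Theta_j^-1 below w; the *)
(* index j is recovered because intervals of length 2 have at most two        *)
(* coatoms. In general one goes from v_i to v_j along coatoms of [z, v], two  *)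
(* consecutive ones covering a common element above z.                        *)
(* These facts on Bruhat intervals follow by induction along a right descent  *)
(* of the top element from the lifting property, itself a consequence of the  *)
(* reflection cocycle w |-> {t | l(wt) < l(w)}.                               *)

(* For [n = 1] both intervals are two-element chains. For [n > 1], equality of the [T_inv]
   components gives Theta_i and Theta'_i a common target, so that Theta_i followed by the inverse of
   Theta'_i is an isomorphism from [u, v_i] onto [u', v'_i]. The theorem holds because these local
   isomorphisms glue together.

   Agreement for two coatoms covering a common w is [Theta_match_step]: [P_inv] supplies the partner
   of w, [A_inv] the transition map below w, and [bruhat_diamond] recovers the index that [A_inv]
   omits. [coatoms_connected] spreads the agreement to all coatoms above a given z, which gives
   [match_rel_mono]. With [match_rel_total] and the symmetry of the situation,
   [poset_isomorphic_rel] produces the isomorphism.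

   Both facts on Bruhat intervals rest on lifting ([bruhat_mul_gen]), and lifting rests on
   [reflection_lengthE], where the cocycle decides whether multiplication by a reflection shortens
   an element. *)
From HB Require Import structures.
Require Import Defs.
From Stdlib Require Import Relation_Operators.
From mathcomp Require Import all_boot.
From mathcomp Require Import all_classical.
From mathcomp Require Import zify.

Set Implicit Arguments.
Unset Strict Implicit.
Unset Printing Implicit Defensive.

Local Open Scope classical_set_scope.
Local Open Scope group_scope.

(* The wreath-like product of W with the functions W -> bool, on which W acts *)
(* by conjugation of the argument. The universal property of W applied to     *)
(* s |-> (s, [r == s]) yields the cocycle r |-> [r is an inversion of w].     *)
Definition twisted (W : groupType) : Type := (W * (W -> bool))%type.

(** * The group carrying the reflection cocycle *)

Section Twisted.
Variable W : groupType.
Implicit Types a b d : twisted W.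

HB.instance Definition _ := Choice.on (twisted W).

Definition tw_mul a b : twisted W :=
  (a.1 * b.1, fun r => a.2 (r ^ b.1^-1) (+) b.2 r).
Definition tw_one : twisted W := (1, fun=> false).
Definition tw_inv a : twisted W := (a.1^-1, fun r => a.2 (r ^ a.1)).

Lemma tw_mulA : associative tw_mul.
Proof.
move=> a b d; rewrite /tw_mul /= mulgA; congr pair.
by apply: funext => r; rewrite invgM conjgM addbA.
Qed.

Lemma tw_mul1 : left_id tw_one tw_mul.
Proof.
by case=> w f; rewrite /tw_mul /= mul1g; congr pair; apply: funext => r.
Qed.

Lemma tw_mulr1 : right_id tw_one tw_mul.
Proof.
case=> w f; rewrite /tw_mul /= mulg1; congr pair; apply: funext => r.
by rewrite invg1 conjg1 addbF.
Qed.

Lemma tw_mulV : left_inverse tw_one tw_inv tw_mul.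
Proof.
case=> w f; rewrite /tw_mul /= mulVg; congr pair; apply: funext => r.
by rewrite conjgKV addbb.
Qed.

Lemma tw_mulrV : right_inverse tw_one tw_inv tw_mul.
Proof.
case=> w f; rewrite /tw_mul /= mulgV; congr pair; apply: funext => r.
by rewrite invgK addbb.
Qed.

HB.instance Definition _ :=
  isGroup.Build (twisted W) tw_mulA tw_mul1 tw_mulr1 tw_mulV tw_mulrV.

Definition tw_gen (s : W) : twisted W := (s, fun r => r == s).

(** The word (st)^k has 2k letters; conjugating each letter by the suffix after it gives the
    reflections (ts)^j t with j < 2k, and the second component counts occurrences of r among them
    modulo 2. *)
Lemma tw_gen_exp (s t : W) k : s * s = 1 -> t * t = 1 ->
  (tw_gen s * tw_gen t) ^+ k =
  ((s * t) ^+ k, fun r => \big[addb/false]_(0 <= j < k.*2)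
                            (r == (t * s) ^+ j * t)) :> twisted W.
Proof.
move=> ss tt.
have sV : s^-1 = s by apply: mulg1_eq.
have tV : t^-1 = t by apply: mulg1_eq.
have V : (s * t)^-1 = t * s by rewrite invgM sV tV.
have comm j : t * (s * t) ^+ j = (t * s) ^+ j * t.
  elim: j => [|j IH]; first by rewrite !expg0 mulg1 mul1g.
  by rewrite expgSr mulgA IH expgSr !mulgA.
elim: k => [|k IH].
  by rewrite !expg0; congr pair; apply: funext => r; rewrite big_geq.
rewrite expgS IH; congr pair; first by rewrite /= expgS.
apply: funext => r /=.
rewrite doubleS !big_nat_recr //= addbC -addbA; congr addb.
have conjE (x y z : W) : (x ^ y^-1 == z) = (x == z ^ y).
  by apply/eqP/eqP => [<-|->]; rewrite ?conjgKV ?conjgK.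
have tJ : t ^ (s * t) ^+ k = (t * s) ^+ k.*2 * t.
  rewrite conjgE comm -expVgn V mulgA -addnn expgnDr //.
rewrite /= !conjE addbC tJ; congr addb; congr (r == _).
rewrite -conjgM.
have -> : s ^ (t * (s * t) ^+ k) = (t * s * t) ^ (s * t) ^+ k.
  by rewrite conjgM; congr (_ ^ _); rewrite conjgE tV mulgA.
rewrite conjgE -(mulgA (t * s)) comm -expVgn V -addnn -addnS expgnDr expgS.
by rewrite !mulgA.
Qed.

(** Since (ts)^m = 1, the 2m reflections of [tw_gen_exp] run twice through the first m, so all
    counts are even. *)
Lemma tw_gen_rel (s t : W) m : s * s = 1 -> t * t = 1 -> (s * t) ^+ m = 1 ->
  (tw_gen s * tw_gen t) ^+ m = 1.
Proof.
move=> ss tt stm; rewrite tw_gen_exp // stm; congr pair; apply: funext => r.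
have tsm : (t * s) ^+ m = 1.
  have sV : s^-1 = s by apply: mulg1_eq.
  have tV : t^-1 = t by apply: mulg1_eq.
  have -> : t * s = (s * t)^-1 by rewrite invgM sV tV.
  by rewrite expVgn stm invg1.
rewrite -addnn (@big_cat_nat _ _ _ m) ?leq_addr //=.
rewrite -{2}[m]add0n big_addn addnK.
under [X in _ (+) X]eq_bigr => j _ do rewrite expgnDr tsm mulg1.
by rewrite addbb.
Qed.

End Twisted.

(** * Length, reflections and inversions *)

Section Coxeter.
Variables (W : groupType) (S : set W).
Hypothesis hS : coxeter_system S.

Lemma gen_sqr s : S s -> s * s = 1.
Proof.
case: hS => m [hm hr _ _] Ss; have [_ h] := hm s s Ss Ss.
by have := hr s s Ss Ss; rewrite (h.2 erefl).
Qed.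

Lemma gen_inv s : S s -> s^-1 = s.
Proof. by move=> /gen_sqr/mulg1_eq. Qed.

Lemma mulgs_gen x s : S s -> x * s * s = x.
Proof. by move=> Ss; rewrite -mulgA gen_sqr ?mulg1. Qed.

Lemma word_ofP w : exists l, word_of S w l.
Proof. by case: hS => m []. Qed.

Lemma word_rcons w l s : word_of S w l -> S s -> word_of S (w * s) (rcons l s).
Proof.
move=> [hl <-] Ss; split; last by rewrite -cats1 big_cat big_seq1.
by move=> x; rewrite mem_rcons inE => /orP[/eqP->//|]; apply: hl.
Qed.

Lemma word_rcons_inv w l s : word_of S w (rcons l s) ->
  S s /\ word_of S (w * s) l.
Proof.
move=> [hl <-].
have Ss : S s by apply: hl; rewrite mem_rcons inE eqxx.
split=> //; split; last by rewrite -cats1 big_cat big_seq1 mulgs_gen.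
by move=> x hx; apply: hl; rewrite mem_rcons inE hx orbT.
Qed.

(** N is the second component of the homomorphism into [twisted W]. The first component is the
    identity, because it fixes the generators; the cocycle rule is then the product of
    [twisted W]. *)
Lemma inversion_cocycle : exists N : W -> W -> bool,
  (forall x y r, N (x * y) r = N x (r ^ y^-1) (+) N y r) /\
  forall s, S s -> N s = eq_op^~ s.
Proof.
have [m [hm hr hw univ]] := hS.
have [|g hg] := univ (twisted W) (@tw_gen W).
  by move=> s t Ss St; apply: tw_gen_rel; rewrite ?gen_sqr ?hr.
have gM x y : g (x * y) = g x * g y by exact: gmulfM.
have g1 : g 1 = 1 by apply: (@mulgI _ (g 1)); rewrite -gM !mulg1.
have fst_g w : (g w).1 = w.
  have [l] := hw w; elim/last_ind: l w => [|l s IH] w.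
    by move=> [_ <-]; rewrite big_nil g1.
  move=> /word_rcons_inv[Ss /IH].
  by rewrite gM (hg s) //= => /mulIg.
exists (fun w => (g w).2); split; last by move=> s Ss; rewrite hg.
by move=> x y r; rewrite gM /= fst_g.
Qed.

Local Notation ell := (cox_length S).

(** Words for w exist, so [xget] never falls back on its default 0. *)
Lemma cox_lengthP w : (exists2 l, word_of S w l & size l = ell w) /\
  forall l, word_of S w l -> (ell w <= size l)%N.
Proof.
rewrite /cox_length; case: xgetP => [k _ //|noP].
exfalso.
have ex : exists k, `[< exists2 l, word_of S w l & size l = k >].
  by have [l hl] := word_ofP w; exists (size l); apply/asboolP; exists l.
case: (ex_minnP ex) => k /asboolP h1 h2.
apply: (noP k); split=> // l hl; apply: h2; apply/asboolP; by exists l.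
Qed.

Lemma cox_length_gen x s : S s -> (ell (x * s) <= (ell x).+1)%N.
Proof.
move=> Ss; have [[l hl <-] _] := cox_lengthP x.
have [_ h] := cox_lengthP (x * s).
by have := h _ (word_rcons hl Ss); rewrite size_rcons.
Qed.

Lemma right_descent x : (0 < ell x)%N ->
  exists2 s, S s & (ell (x * s) < ell x)%N.
Proof.
have [[l hl <-] _] := cox_lengthP x.
case/lastP: l hl => // l s /word_rcons_inv[Ss hl] _; exists s => //.
by have [_ h] := cox_lengthP (x * s); rewrite size_rcons ltnS h.
Qed.

Lemma reflection_gen s : S s -> reflection S s.
Proof. by move=> Ss; exists 1, s; rewrite mul1g invg1 mulg1. Qed.

Lemma reflectionJ t s : reflection S t -> S s -> reflection S (t ^ s).
Proof.
move=> [w [s' [Ss' ->]]] Ss; exists (s * w), s'; split=> //.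
by rewrite conjgE invgM (gen_inv Ss) !mulgA.
Qed.

(** This is strong exchange: if N x t holds, deleting a letter from a reduced word of x gives a word
    of xt. The converse follows because N t t holds, so that exactly one of x and xt has t as an
    inversion. *)
Lemma reflection_lengthE : exists N : W -> W -> bool,
  [/\ forall x s r, S s -> N (x * s) r = N x (r ^ s) (+) (r == s),
      forall x t, reflection S t -> N x t = (ell (x * t) < ell x)%N
    & forall x t, reflection S t -> ~~ N x t = (ell x < ell (x * t))%N].
Proof.
have [N [NM Ns]] := inversion_cocycle.
have N1 r : N 1 r = false.
  by have := NM 1 1 r; rewrite invg1 conjg1 mulg1; case: (N 1 r).
have Ngen x s r : S s -> N (x * s) r = N x (r ^ s) (+) (r == s).
  by move=> Ss; rewrite NM (Ns _ Ss) (gen_inv Ss).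
have Nlt x t : N x t -> (ell (x * t) < ell x)%N.
  have [[l hl <-] _] := cox_lengthP x => hN.
  suff [l' hl' lt] : exists2 l', word_of S (x * t) l' & (size l' < size l)%N.
    by apply: leq_ltn_trans lt; have [_] := cox_lengthP (x * t); apply.
  elim/last_ind: l x t hl hN => [|l s IH] x t.
    by move=> [_ <-]; rewrite big_nil N1.
  move=> /word_rcons_inv[Ss hl].
  rewrite -{1}(mulgs_gen x Ss) Ngen //; have [->|nts] := eqVneq t s => hN.
    by exists l; rewrite ?size_rcons.
  rewrite addbF in hN; have [l' hl' lt] := IH _ _ hl hN.
  exists (rcons l' s); last by rewrite !size_rcons.
  have -> : x * t = x * s * t ^ s * s.
    by rewrite conjgE (gen_inv Ss) !mulgA !mulgs_gen.
  exact: word_rcons.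
(* For t = w s w^-1, the cocycle rule at w w^-1 = 1 makes the contributions of w and w^-1 cancel,
   leaving N s s. *)
have Nt t : reflection S t -> N t t.
  move=> [w [s [Ss ->]]]; set t' := _ * _.
  have t'w : t' ^ w = s by rewrite conjgE /t' -!mulgA mulVg mulg1 mulKg.
  have := NM w w^-1 t'; rewrite mulgV N1 invgK t'w => h.
  rewrite {1}/t' NM invgK t'w Ngen // eqxx conjgE mulKg.
  by case: (N w s) h; case: (N w^-1 t').
have NtN x t : reflection S t -> N (x * t) t = ~~ N x t.
  by move=> ht; rewrite NM Nt // addbT conjgE invgK mulgA mulgK.
have tt t : reflection S t -> t * t = 1.
  move=> [w [s [Ss ->]]].
  by rewrite !mulgA mulgVK -[w * s * s]mulgA gen_sqr // mulg1 mulgV.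
have NNlt x t : reflection S t -> ~~ N x t -> (ell x < ell (x * t))%N.
  move=> ht; rewrite -NtN // => /Nlt.
  by rewrite -mulgA tt // mulg1.
exists N; split=> // x t ht; case hN: (N x t).
- by rewrite Nlt.
- by have := NNlt _ _ ht (negbT hN); lia.
- by have := Nlt _ _ hN; lia.
- by rewrite NNlt // hN.
Qed.

Lemma cox_length_gen_cases x s : S s ->
  ell (x * s) = (ell x).+1 \/ ell x = (ell (x * s)).+1.
Proof.
move=> Ss; have [N [_ N1 N2]] := reflection_lengthE.
have := N1 x s (reflection_gen Ss); have := N2 x s (reflection_gen Ss).
have := cox_length_gen x Ss; have := cox_length_gen (x * s) Ss.
rewrite mulgs_gen //; case: (N x s) => /=; lia.
Qed.

(** For t different from s, the reflection t^s is not s, so N (xs) (t^s) = N x t: the step keeps its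
    direction after right multiplication by s. *)
Lemma bruhat_step_gen x y s : S s -> bruhat_step S x y ->
  y = x * s \/ bruhat_step S (x * s) (y * s).
Proof.
move=> Ss [t [ht -> lt]]; have [->|nts] := eqVneq t s; first by left.
have e : x * t * s = x * s * t ^ s.
  by rewrite conjgE (gen_inv Ss) !mulgA (mulgs_gen _ Ss).
right; have hts := reflectionJ ht Ss; exists (t ^ s); split=> //.
have [N [NM _ N2]] := reflection_lengthE.
rewrite e -N2 // NM // -conjgM gen_sqr // conjg1.
have -> : (t ^ s == s) = false.
  apply: contra_neqF nts => /eqP h.
  by rewrite -[t](conjgK s) h conjgE !(gen_inv Ss) gen_sqr // mulg1.
by rewrite addbF N2.
Qed.
End Coxeter.

(** * The lifting property and coatoms of Bruhat intervals *)

Section BruhatOrder.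
Variables (W : groupType) (S : set W).
Hypothesis hS : coxeter_system S.
Local Notation ell := (cox_length S).
Local Notation le := (bruhat_le S).
Local Notation cover := (bruhat_cover S).
Implicit Types x y z w a b s : W.

Lemma bruhat_refl x : le x x.
Proof. exact: rt_refl. Qed.

Lemma bruhat_trans y x z : le x y -> le y z -> le x z.
Proof. exact: rt_trans. Qed.

Lemma bruhat_le_length x y : le x y -> x = y \/ (ell x < ell y)%N.
Proof.
elim=> {x y} [x y [t []]|x|x y z _ h1 _ h2]; [by right|by left|].
by case: h1 => [->//|h1]; right; case: h2 => [<-//|]; apply: ltn_trans.
Qed.

Lemma bruhat_length_le x y : le x y -> (ell x <= ell y)%N.
Proof. by case/bruhat_le_length => [->//|/ltnW]. Qed.

Lemma bruhat_le_eq x y : le x y -> (ell y <= ell x)%N -> x = y.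
Proof. by case/bruhat_le_length => //; lia. Qed.

Lemma bruhat_anti x y : le x y -> le y x -> x = y.
Proof. by move=> h /bruhat_length_le; apply: bruhat_le_eq. Qed.

Lemma bruhat_coverP x y : cover x y <-> le x y /\ ell y = (ell x).+1.
Proof.
split=> [[[h _] e] //|[h e]]; split=> //; split=> // exy.
by move: e; rewrite exy; lia.
Qed.

Lemma bruhat_le_gen x s : S s -> (ell x < ell (x * s))%N -> le x (x * s).
Proof.
move=> Ss h; apply: rt_step.
by exists s; split=> //; exact: reflection_gen.
Qed.

Lemma bruhat_ge_gen x s : S s -> (ell (x * s) < ell x)%N -> le (x * s) x.
Proof.
move=> Ss h; rewrite -{2}(mulgs_gen hS x Ss); apply: bruhat_le_gen => //.
by rewrite (mulgs_gen hS).
Qed.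

(** A form of lifting free of length hypotheses, so that it composes along chains of Bruhat steps.
    The four lifting lemmas below each add one descent condition. *)
Lemma bruhat_mul_gen x y s : S s -> le x y ->
  (le (x * s) (y * s) \/ le (x * s) y) /\ (le (x * s) (y * s) \/ le x (y * s)).
Proof.
move=> Ss; elim=> {x y} [x y xy|x|x y z xy [IH1 IH2] yz [IH3 IH4]].
- have [->|h] := bruhat_step_gen hS Ss xy.
    by rewrite (mulgs_gen hS x Ss); split; right; exact: bruhat_refl.
  by split; left; apply: rt_step.
- by split; left; exact: bruhat_refl.
- split.
    case: IH1 => h; last by right; exact: bruhat_trans yz.
    by case: IH3 => h'; [left|right]; exact: bruhat_trans h'.
  case: IH4 => h; last by right; exact: bruhat_trans h.
  by case: IH2 => h'; [left|right]; exact: bruhat_trans h.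
Qed.

Lemma bruhat_lift_up x y s : S s -> le x y -> (ell y < ell (y * s))%N ->
  le (x * s) (y * s).
Proof.
move=> Ss xy ys; have [[//|h] _] := bruhat_mul_gen Ss xy.
exact: bruhat_trans (bruhat_le_gen Ss ys).
Qed.

Lemma bruhat_lift_down x y s : S s -> le x y -> (ell (x * s) < ell x)%N ->
  le (x * s) (y * s).
Proof.
move=> Ss xy xs; have [_ [//|h]] := bruhat_mul_gen Ss xy.
exact: bruhat_trans (bruhat_ge_gen Ss xs) h.
Qed.

Lemma bruhat_lift_l x y s : S s -> le x y -> (ell (y * s) < ell y)%N ->
  le (x * s) y.
Proof.
move=> Ss xy ys; have [[h|//] _] := bruhat_mul_gen Ss xy.
exact: bruhat_trans (bruhat_ge_gen Ss ys).
Qed.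

Lemma bruhat_lift_r x y s : S s -> le x y -> (ell x < ell (x * s))%N ->
  le x (y * s).
Proof.
move=> Ss xy xs; have [_ [h|//]] := bruhat_mul_gen Ss xy.
exact: bruhat_trans (bruhat_le_gen Ss xs) h.
Qed.

(** Let s be a right descent of y. If x < xs, then ys serves. Otherwise a coatom z of [xs, ys] gives
    zs when z < zs, and ys when not. *)
Lemma bruhat_coatom x y : le x y -> x <> y -> exists2 z, le x z & cover z y.
Proof.
have [k] := ubnP (ell y); elim: k x y => // k IH x y /ltnSE yk xy nxy.
have xly : (ell x < ell y)%N by case: (bruhat_le_length xy).
have [s Ss ys] := right_descent hS (leq_ltn_trans (leq0n _) xly).
have ysy := bruhat_ge_gen Ss ys.
have cys : cover (y * s) y.
  by apply/bruhat_coverP; split=> //; have := cox_length_gen_cases hS y Ss; lia.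
have [xs|xs] := cox_length_gen_cases hS x Ss.
  by exists (y * s) => //; apply: bruhat_lift_r => //; lia.
have xsys : le (x * s) (y * s) by apply: bruhat_lift_down => //; lia.
have [||z xz] := IH _ _ _ xsys; [lia|by move/mulIg|].
move=> /bruhat_coverP[zy lz].
have [zs|zs] := cox_length_gen_cases hS z Ss.
  exists (z * s).
    by rewrite -(mulgs_gen hS x Ss); apply: bruhat_lift_up => //; lia.
  apply/bruhat_coverP; split; last by have := cox_length_gen_cases hS y Ss; lia.
  by apply: bruhat_lift_l => //; exact: bruhat_trans ysy.
exists (y * s) => //; apply: bruhat_trans zy.
by rewrite -(mulgs_gen hS x Ss); apply: bruhat_lift_l => //; lia.
Qed.

(** If z < zs, lifting puts z below ys, and the two have equal length. *)
Lemma bruhat_cover_descent z y s : S s -> cover z y -> (ell (y * s) < ell y)%N ->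
  z = y * s \/ (ell (z * s) < ell z)%N.
Proof.
move=> Ss /bruhat_coverP[zy lz] ys.
have [zs|zs] := cox_length_gen_cases hS z Ss; last by right; lia.
left; apply: bruhat_le_eq; last lia.
by apply: bruhat_lift_r => //; lia.
Qed.

(** Let s be a right descent of y. If x < xs, the only possible coatoms are ys and xs. If xs < x,
    the map F injects the coatoms of [x, y] into those of [xs, ys], and induction applies. *)
Lemma bruhat_diamond x y a b d : ell y = (ell x).+2 ->
  le x a -> le x b -> le x d -> cover a y -> cover b y -> cover d y ->
  [\/ a = b, a = d | b = d].
Proof.
have [k] := ubnP (ell y); elim: k x y a b d => // k IH x y a b d /ltnSE yk lxy.
have [|s Ss ys] := right_descent hS (_ : (0 < ell y)%N); first lia.
have lys := cox_length_gen_cases hS y Ss.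
have [xs|xs] := cox_length_gen_cases hS x Ss.
  have dich z : le x z -> cover z y -> z = y * s \/ z = x * s.
    move=> xz cz; have [->|zs] := bruhat_cover_descent Ss cz ys; first by left.
    have /bruhat_coverP[_ lz] := cz.
    by right; apply/esym/bruhat_le_eq; [exact: bruhat_lift_l|lia].
  move=> xa xb xd ca cb cd.
  by case: (dich a) => // ->; case: (dich b) => // ->; case: (dich d) => // ->;
    (exact: Or31) || (exact: Or32) || (exact: Or33).
(* The coatom ys needs its own value, since multiplying it by s gives y, which is not below ys. *)
pose F z := if z == y * s then x else z * s.
have hF z : le x z -> cover z y -> le (x * s) (F z) /\ cover (F z) (y * s).
  move=> xz cz; rewrite /F; have [e|/eqP ne] := eqVneq z (y * s).
    split; first by apply: bruhat_ge_gen => //; lia.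
    by apply/bruhat_coverP; split; [rewrite -e|lia].
  have [//|zs] := bruhat_cover_descent Ss cz ys.
  have /bruhat_coverP[zy lz] := cz.
  split; first by apply: bruhat_lift_down => //; lia.
  apply/bruhat_coverP; split; first exact: bruhat_lift_down.
  by have := cox_length_gen_cases hS z Ss; lia.
have Finj z z' : le x z -> le x z' -> F z = F z' -> z = z'.
  have no w : le x w -> x <> w * s.
    move=> /bruhat_length_le xw e.
    by have := mulgs_gen hS w Ss; rewrite -e => ew; move: xw; rewrite -ew; lia.
  move=> xz xz'; rewrite /F.
  have [->|_] := eqVneq z (y * s); have [->|_] := eqVneq z' (y * s) => //.
  - by move/no; case.
  - by move/esym/no; case.
  - by move/mulIg.
move=> xa xb xd ca cb cd.
have [xFa cFa] := hF a xa ca; have [xFb cFb] := hF b xb cb.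
have [xFd cFd] := hF d xd cd.
have [||e|e|e] := IH _ _ _ _ _ _ _ xFa xFb xFd cFa cFb cFd; [lia|lia|..].
- by apply: Or31; apply: Finj e.
- by apply: Or32; apply: Finj e.
- by apply: Or33; apply: Finj e.
Qed.

(* This says, as an induction principle, that any two coatoms of [z, v] are   *)
(* joined by a path of coatoms in which consecutive ones cover a common       *)
(* element above z. With s a right descent of v: if z < zs, every coatom a    *)
(* other than vs is joined to vs through as; if zs < z, the map F below       *)
(* carries paths of [zs, vs] to paths of [z, v].                              *)
Lemma coatoms_connected z v (Q : W -> Prop) :
  (forall a b w, cover a v -> cover b v -> le z w -> cover w a -> cover w b ->
     Q a -> Q b) ->
  forall a b, le z a -> cover a v -> le z b -> cover b v -> Q a -> Q b.
Proof.
have [k] := ubnP (ell v); elim: k z v Q => // k IH z v Q /ltnSE vk step a b.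
move=> za ca zb cb.
have [/bruhat_coverP[av la] /bruhat_coverP[bv lb]] := (ca, cb).
have [|s Ss vs] := right_descent hS (_ : (0 < ell v)%N); first lia.
have cvs : cover (v * s) v.
  apply/bruhat_coverP; split; first exact: bruhat_ge_gen.
  by have := cox_length_gen_cases hS v Ss; lia.
have /bruhat_coverP[vsv lvs] := cvs.
have descE x := cox_length_gen_cases hS x Ss.
have cdown x : cover x v -> (ell (x * s) < ell x)%N -> cover (x * s) (v * s).
  move=> /bruhat_coverP[xv lx] xs; apply/bruhat_coverP.
  by split; [exact: bruhat_lift_down|have := descE x; lia].
have cself x : (ell (x * s) < ell x)%N -> cover (x * s) x.
  move=> xs; apply/bruhat_coverP.
  by split; [exact: bruhat_ge_gen|have := descE x; lia].
have cselfV x : (ell x < ell (x * s))%N -> cover x (x * s).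
  move=> xs; apply/bruhat_coverP.
  by split; [exact: bruhat_le_gen|have := descE x; lia].
have [zs|zs] := descE z.
  have link x : le z x -> cover x v -> x = v * s \/
      [/\ le z (x * s), cover (x * s) x & cover (x * s) (v * s)].
    move=> zx cx; have [->|xs] := bruhat_cover_descent Ss cx vs; first by left.
    right; split; [|exact: cself|exact: cdown].
    by apply: bruhat_lift_r => //; lia.
  move=> Qa; have Qvs : Q (v * s).
    have [<-//|[h1 h2 h3]] := link a za ca.
    exact: (step _ _ _ ca cvs h1 h2 h3 Qa).
  have [->//|[h1 h2 h3]] := link b zb cb.
  exact: (step _ _ _ cvs cb h1 h3 h2 Qvs).
have [short|long] := leqP (ell v) (ell z).+1.
  have ea : z = a by apply: bruhat_le_eq => //; lia.
  have eb : z = b by apply: bruhat_le_eq => //; lia.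
  by rewrite -ea -eb.
have zup x : le (z * s) x -> (ell x < ell (x * s))%N -> le z (x * s).
  by move=> zx xs; rewrite -(mulgs_gen hS z Ss); exact: bruhat_lift_up.
have zin x : le (z * s) x -> (ell (x * s) < ell x)%N -> le z x.
  by move=> zx xs; rewrite -(mulgs_gen hS z Ss); exact: bruhat_lift_l.
pose F x := if (ell x < ell (x * s))%N then x * s else v * s.
have cup x : cover x (v * s) -> (ell x < ell (x * s))%N -> cover (x * s) v.
  move=> /bruhat_coverP[xv lx] xs; apply/bruhat_coverP.
  split; last by have := descE x; lia.
  by rewrite -(mulgs_gen hS v Ss); apply: bruhat_lift_up; rewrite ?(mulgs_gen hS).
have stepF x y w : cover x (v * s) -> cover y (v * s) -> le (z * s) w ->
    cover w x -> cover w y -> Q (F x) -> Q (F y).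
  (* The mixed case, where F x' = x's and F y' = vs: the element covered by both is y' = w's if w'
     goes up under s, and x' otherwise. *)
  have one x' y' w' : cover x' (v * s) -> cover y' (v * s) -> le (z * s) w' ->
      cover w' x' -> cover w' y' -> (ell x' < ell (x' * s))%N ->
      (ell (y' * s) < ell y')%N ->
      exists w, [/\ le z w, cover w (x' * s) & cover w (v * s)].
    move=> cx cy zw cwx cwy xs ys.
    have [/bruhat_coverP[wx lwx] /bruhat_coverP[wy lwy]] := (cwx, cwy).
    have [ws|ws] := descE w'.
      have e : w' * s = y'.
        by apply: bruhat_le_eq; [exact: bruhat_lift_l|lia].
      exists y'; split=> //; first by rewrite -e; apply: zup => //; lia.
      rewrite -e; apply/bruhat_coverP; split; last by have := descE x'; lia.
      exact: bruhat_lift_up.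
    exists x'; split=> //; last exact: cselfV.
    by apply: bruhat_trans wx; apply: zin => //; lia.
  move=> cx cy zw cwx cwy; rewrite /F.
  have [xs|xs] := ltnP (ell x); have [ys|ys] := ltnP (ell y) => // Qx.
  - have [/bruhat_coverP[wx lwx] /bruhat_coverP[wy lwy]] := (cwx, cwy).
    have [ws|ws] := descE w.
      apply: (step _ _ (w * s)) Qx; try exact: cup.
      + by apply: zup => //; lia.
      + apply/bruhat_coverP; split; first exact: bruhat_lift_up.
        by have := descE x; lia.
      + apply/bruhat_coverP; split; first exact: bruhat_lift_up.
        by have := descE y; lia.
    have zw' : le z w by apply: zin => //; lia.
    (* When ws < w, the path goes from xs to vs through x, and from vs to ys through y. *)
    apply: (step (v * s) _ y) => //; try exact: cup; try exact: cselfV.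
      exact: bruhat_trans wy.
    apply: (step (x * s) _ x) => //; try exact: cup; try exact: cselfV.
    exact: bruhat_trans wx.
  - have [|w' [h1 h2 h3]] := one x y w cx cy zw cwx cwy xs.
      by have := descE y; lia.
    by apply: (step _ _ w') Qx => //; exact: cup.
  - have [|w' [h1 h2 h3]] := one y x w cy cx zw cwy cwx ys.
      by have := descE x; lia.
    by apply: (step _ _ w') Qx => //; exact: cup.
(* A coatom x with xs < x is F (xs). The coatom vs is only linked to an F y, with y any coatom of
   [z, vs]; such a y exists because v is more than one level above z. *)
have imF x : le z x -> cover x v ->
    exists y, [/\ le (z * s) y, cover y (v * s) & Q x <-> Q (F y)].
  move=> zx cx; have [ex|xs] := bruhat_cover_descent Ss cx vs; last first.
    exists (x * s); split; [|exact: cdown|].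
      by apply: bruhat_lift_down => //; lia.
    by rewrite /F (mulgs_gen hS) // xs.
  have [||y zy cy] := @bruhat_coatom z (v * s); [by rewrite -ex| |].
    by move=> e; move: long; rewrite e; lia.
  exists y; split=> //.
    by apply: bruhat_trans zy; apply: bruhat_ge_gen => //; lia.
  rewrite /F ex; have [ys|//] := ltnP (ell y).
  by split; apply: (step _ _ y) => //; try exact: cup; exact: cselfV.
have [a' [za' ca' Qaa']] := imF a za ca.
have [b' [zb' cb' Qbb']] := imF b zb cb.
move/Qaa' => Qa; apply/Qbb'.
apply: (IH _ _ (fun x => Q (F x)) _ stepF _ _ za' ca' zb' cb' Qa).
lia.
Qed.

End BruhatOrder.

(** * Isomorphisms between intervals *)

Section PosetIso.
Variables (W : groupType) (S : set W).
Local Notation le := (bruhat_le S).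
Implicit Types p q : W * W.

Lemma poset_iso_in p q f x : poset_iso S p q f -> interval S p x ->
  interval S q (f x).
Proof. by move=> [[h _ _] _]; exact: h. Qed.

Lemma poset_iso_inj p q f x y : poset_iso S p q f ->
  interval S p x -> interval S p y -> f x = f y -> x = y.
Proof. by move=> [[_ h _] _] px py; apply: h; rewrite inE. Qed.

Lemma poset_iso_surj p q f y : poset_iso S p q f -> interval S q y ->
  exists2 x, interval S p x & f x = y.
Proof. by move=> [[_ _ h] _] /h. Qed.

Lemma poset_iso_mono p q f x y : poset_iso S p q f ->
  interval S p x -> interval S p y -> (le x y <-> le (f x) (f y)).
Proof. by move=> [_]; apply. Qed.

Lemma poset_iso_id p : poset_iso S p p idfun.
Proof. by split=> //; split=> // x px; exists x. Qed.

Lemma poset_iso_comp p q r f g : poset_iso S p q f -> poset_iso S q r g ->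
  poset_iso S p r (g \o f).
Proof.
move=> hf hg; split; last first.
  move=> x y px py; rewrite (poset_iso_mono hf px py).
  exact: (poset_iso_mono hg (poset_iso_in hf px) (poset_iso_in hf py)).
split=> [x /(poset_iso_in hf)/(poset_iso_in hg) //| |z].
  move=> x y /set_mem px /set_mem py /= e; apply: (poset_iso_inj hf) => //.
  by apply: (poset_iso_inj hg) e; exact: (poset_iso_in hf).
by move=> /(poset_iso_surj hg)[y /(poset_iso_surj hf)[x px <-] <-]; exists x.
Qed.

Lemma interval_bot p : le p.1 p.2 -> interval S p p.1.
Proof. by move=> h; split=> //; exact: bruhat_refl. Qed.

Lemma poset_iso_bot p q f : le p.1 p.2 -> le q.1 q.2 -> poset_iso S p q f ->
  f p.1 = q.1.
Proof.
move=> hp hq hf; have pb := interval_bot hp.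
have [x px fx] := poset_iso_surj hf (interval_bot hq).
apply: (@bruhat_anti _ S); last by case: (poset_iso_in hf pb).
by rewrite -fx; apply/(poset_iso_mono hf pb px); case: px.
Qed.

(** Applying the order condition to equal arguments on one side, antisymmetry makes F single-valued
    and injective; choice then extracts the map. *)
Lemma poset_isomorphic_rel p q (F : W -> W -> Prop) :
  (forall x, interval S p x -> exists2 y, interval S q y & F x y) ->
  (forall y, interval S q y -> exists2 x, interval S p x & F x y) ->
  (forall x x' y y', interval S p x -> interval S p x' ->
     interval S q y -> interval S q y' -> F x y -> F x' y' ->
     (le x x' <-> le y y')) ->
  poset_isomorphic S p q.
Proof.
move=> tot surj mono.
have /choice[f hf] : forall x, exists y, interval S p x -> interval S q y /\ F x y.
  move=> x; case: (pselect (interval S p x)) => [/tot[y qy Fxy]|npx].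
    by exists y.
  by exists x.
exists f; split; last first.
  move=> x y px py; have [qx Fx] := hf x px; have [qy Fy] := hf y py.
  exact: mono.
split=> [x /hf[]//| |y qy].
  move=> x y /set_mem px /set_mem py e.
  have [qx Fx] := hf x px; have [qy Fy] := hf y py.
  have xy := mono _ _ _ _ px py qx qy Fx Fy.
  have yx := mono _ _ _ _ py px qy qx Fy Fx.
  by apply: (@bruhat_anti _ S); [apply/xy|apply/yx]; rewrite e; exact: bruhat_refl.
have [x px Fxy] := surj y qy; exists x => //.
have [qx Fx] := hf x px.
have xx := bruhat_refl S x; apply: (@bruhat_anti _ S).
  exact/(mono _ _ _ _ px px qx qy Fx Fxy).
exact/(mono _ _ _ _ px px qy qx Fxy Fx).
Qed.

End PosetIso.

(** * Gluing the local isomorphisms of two intervals with the same triple *)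

Section Match.
Variables (W : groupType) (S : set W).
Hypothesis hS : coxeter_system S.
Variables (n : nat) (D : interval_data S n).
Local Notation ell := (cox_length S).
Local Notation le := (bruhat_le S).
Local Notation cover := (bruhat_cover S).

(** The hypotheses in a form symmetric in the two intervals, so that lemmas for one direction also
    serve the other. Equality of [T_inv] survives as the common target q. *)
Record tpa_match (u v : W) (c : seq W) (psi : nat -> W -> W)
    (u' v' : W) (c' : seq W) (psi' : nat -> W -> W) : Prop := TpaMatch {
  match_interval : is_interval S n (u, v);
  match_interval' : is_interval S n (u', v');
  match_enum : coatom_enum S (u, v) c;
  match_enum' : coatom_enum S (u', v') c';
  match_size : size c = size c';
  match_Theta : forall i, (i < size c)%N -> exists q,
    [/\ is_interval S n.-1 q,
        poset_iso S (u, coatom u c i) q (Theta D u c psi i)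
      & poset_iso S (u', coatom u' c' i) q (Theta D u' c' psi' i)];
  match_P : P_inv D u v c psi = P_inv D u' v' c' psi';
  match_A : A_inv D u v c psi = A_inv D u' v' c' psi'
}.

Lemma tpa_match_sym u v c psi u' v' c' psi' :
  tpa_match u v c psi u' v' c' psi' -> tpa_match u' v' c' psi' u v c psi.
Proof.
case=> h1 h2 h3 h4 h5 h6 h7 h8; split=> // i; rewrite -h5 => /h6[q [? ? ?]].
by exists q.
Qed.

Lemma coatom_enumP u v c i : coatom_enum S (u, v) c -> (i < size c)%N ->
  [/\ le u (coatom u c i), u <> coatom u c i & cover (coatom u c i) v].
Proof.
move=> [_ hc] ic; have /hc[[h1 h2] h3] : coatom u c i \in c by exact: mem_nth.
by split.
Qed.

Lemma phi_inj_interval q x : (0 < n)%N -> is_interval S n.-1 q ->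
  interval S q x -> {in interval S (q.1, x) &, injective (phi D (q.1, x))}.
Proof.
move=> n0 [hq lq] [qx xq] a b /set_mem ha /set_mem hb e.
have [||r _ hr] := @phi_iso _ _ _ D (ell x - ell q.1)%N (q.1, x).
- by have := bruhat_length_le xq; have := bruhat_length_le qx; lia.
- by split=> //=; have := bruhat_length_le qx; lia.
exact: (poset_iso_inj hr).
Qed.

(** Uniqueness of the representative identifies the target of [phi] with [rep_of], whose default p
    is never taken. *)
Lemma phi_rep k p : (k < n)%N -> is_interval S k p ->
  reps D k (rep_of D k p) /\ poset_iso S p (rep_of D k p) (phi D p).
Proof.
move=> kn hp; have [q [[rq iq] uq]] := reps_unique D kn hp.
have -> : rep_of D k p = q.
  rewrite /rep_of; case: xgetP => [q' _ h|/(_ q)]; last by case.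
  by rewrite (uq q').
split=> //; have [q' rq' hq'] := phi_iso D kn hp.
by rewrite (uq q') //; split=> //; exists (phi D p).
Qed.

Lemma interval_coatom u v c i w : coatom_enum S (u, v) c -> (i < size c)%N ->
  interval S (u, coatom u c i) w -> interval S (u, v) w.
Proof.
move=> hc ic [h1 h2]; split=> //; apply: bruhat_trans h2 _.
by have [_ _ /bruhat_coverP[]] := coatom_enumP hc ic.
Qed.

Section HalfMatch.
Variables (u v : W) (c : seq W) (psi : nat -> W -> W).
Variables (u' v' : W) (c' : seq W) (psi' : nat -> W -> W).
Hypothesis n2 : (1 < n)%N.
Hypothesis M : tpa_match u v c psi u' v' c' psi'.
Local Notation Th := (Theta D u c psi).
Local Notation Th' := (Theta D u' c' psi').
Local Notation v_ := (coatom u c).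
Local Notation v'_ := (coatom u' c').

Lemma P_match i j w : (i < size c)%N -> (j < size c)%N -> i <> j ->
  interval S (u, v) w -> cover w (v_ i) -> cover w (v_ j) ->
  exists w', [/\ interval S (u', v') w', cover w' (v'_ i), cover w' (v'_ j),
    Th i w = Th' i w' & Th j w = Th' j w'].
Proof.
wlog ij : i j / (i < j)%N => [hw|] ic jc nij hw0 ci cj.
  have [ij|ji|//] := ltngtP i j; first exact: hw.
  have [w' [h1 h2 h3 h4 h5]] := hw j i ji jc ic (nesym nij) hw0 cj ci.
  by exists w'.
have : P_inv D u v c psi (i, j, Th i w, Th j w).
  by exists i, j, w; split=> //; rewrite ij jc.
rewrite (match_P M) => -[i1 [j1 [w' [_ h1 h2 h3 [ei ej ew1 ew2]]]]].
by exists w'; rewrite ei ej in ew1 ew2 *.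
Qed.

(** Both sides have the same Theta values at the bottom and at w, hence the same maps [phi] around
    the transition map. Equal tau therefore means equal transition maps from index j to index i
    below w; evaluating them at Theta_j z gives the claim. *)
Lemma Theta_match_step i j w z z' : (i < size c)%N -> (j < size c)%N ->
  cover w (v_ i) -> cover w (v_ j) -> le u z -> le z w ->
  interval S (u', v'_ i) z' -> Th i z = Th' i z' ->
  interval S (u', v'_ j) z' /\ Th j z = Th' j z'.
Proof.
move=> ic jc ci cj uz zw iz' ez.
have [<-//|/eqP nij] := eqVneq i j.
have [wi _] := (bruhat_coverP S w (v_ i)).1 ci.
have [wj _] := (bruhat_coverP S w (v_ j)).1 cj.
have uw := bruhat_trans uz zw.
have wuv : interval S (u, v) w by apply: (interval_coatom (match_enum M) ic); split.
have ic' : (i < size c')%N by rewrite -(match_size M).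
have jc' : (j < size c')%N by rewrite -(match_size M).
have [w' [w'uv' ci' cj' ewi ewj]] := P_match ic jc nij wuv ci cj.
have [w'i _] := (bruhat_coverP S w' (v'_ i)).1 ci'.
have [w'j lw'j] := (bruhat_coverP S w' (v'_ j)).1 cj'.
have [uw' _] := w'uv'.
have [qi [hqi Ii Ii']] := match_Theta M ic.
have [qj [hqj Ij Ij']] := match_Theta M jc.
have [[uvi _ _] [uvj _ _]] :=
  (coatom_enumP (match_enum M) ic, coatom_enumP (match_enum M) jc).
have [[uvi' _ cvi'] [uvj' _ cvj']] :=
  (coatom_enumP (match_enum' M) ic', coatom_enumP (match_enum' M) jc').
have bi : Th i u = qi.1 := @poset_iso_bot _ _ (u, v_ i) _ _ uvi hqi.1 Ii.
have bj : Th j u = qj.1 := @poset_iso_bot _ _ (u, v_ j) _ _ uvj hqj.1 Ij.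
have bi' : Th' i u' = qi.1 := @poset_iso_bot _ _ (u', v'_ i) _ _ uvi' hqi.1 Ii'.
have bj' : Th' j u' = qj.1 := @poset_iso_bot _ _ (u', v'_ j) _ _ uvj' hqj.1 Ij'.
have zi : interval S (u, v_ i) z by split=> //; exact: bruhat_trans wi.
have zj : interval S (u, v_ j) z by split=> //; exact: bruhat_trans wj.
have wi_ : interval S (u, v_ i) w by split.
have wj_ : interval S (u, v_ j) w by split.
have w'i_ : interval S (u', v'_ i) w' by split.
have w'j_ : interval S (u', v'_ j) w' by split.
have z'w' : le z' w'.
  apply/(poset_iso_mono Ii' iz' w'i_); rewrite -ez -ewi.
  exact/(poset_iso_mono Ii zi wi_).
have z'j : interval S (u', v'_ j) z'.
  by split; [case: iz'|exact: bruhat_trans w'j].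
split=> //.
have : A_inv D u v c psi (i, Th i w, tau D u c psi i j w).
  by exists i, j, w; split=> //; split=> //; exact/nesym.
rewrite (match_A M) => -[i1 [j1 [w1 [[_ j1c ne1] w1uv' c1i c1j [ei]]]]].
rewrite -{i1}ei in ne1 c1i *.
have [w1i _] := (bruhat_coverP S w1 (v'_ i)).1 c1i.
have w1i_ : interval S (u', v'_ i) w1 by split=> //; case: w1uv'.
rewrite ewi => /(poset_iso_inj Ii' w'i_ w1i_) ew1.
rewrite -{w1}ew1 in w1uv' c1i c1j w1i w1i_ *.
(* The entry of [A_inv] does not record the second index, but [x, v'] with x = w' has length 2 and
   so at most two coatoms. *)
have -> : j1 = j.
  have [w'j1 _] := (bruhat_coverP S w' (v'_ j1)).1 c1j.
  have [_ _ cvj1'] := coatom_enumP (match_enum' M) j1c.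
  have [_ lvj] := (bruhat_coverP S (v'_ j) v').1 cvj'.
  have uq : uniq c' by case: (match_enum' M).
  have [|/eqP|/eqP|/eqP] := bruhat_diamond hS _ w'i w'j w'j1 cvi' cvj' cvj1'.
  - by rewrite lvj lw'j.
  - by rewrite nth_uniq // => /eqP.
  - by rewrite nth_uniq // => /eqP e; case: ne1.
  - by rewrite nth_uniq // => /eqP.
move=> etau.
set a := Th j z.
have ja : interval S (qj.1, Th j w) a.
  split; first by have [] := poset_iso_in Ij zj.
  exact/(poset_iso_mono Ij zj wj_).
have n0 : (0 < n)%N by lia.
have injj := phi_inj_interval n0 hqj (poset_iso_in Ij wj_).
have inji := phi_inj_interval n0 hqi (poset_iso_in Ii wi_).
have : tau D u c psi i j w
    (phi D (qj.1, Th j w) a, tau_fun D u c psi i j w (phi D (qj.1, Th j w) a)).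
  by split=> //=; rewrite /Theta_interval bj; exists a.
rewrite etau => -[_ /=].
rewrite /tau_fun /= /Theta_interval bi bj bi' bj' -ewi -ewj.
rewrite pinvKV ?inE //.
(* The partner of z according to index j; injectivity of [phi] and Theta'_i will show that it equals
   z'. *)
have [y yj ya] := poset_iso_surj Ij' (poset_iso_in Ij zj).
have yw' : le y w'.
  by apply/(poset_iso_mono Ij' yj w'j_); rewrite ya -ewj; case: ja.
have injon x r q f : poset_iso S (r, x) q f -> forall t, le t x ->
    {in interval S (r, t) &, injective f}.
  move=> hf t tx a1 a2 /set_mem[h1 h2] /set_mem[h3 h4].
  apply: (poset_iso_inj hf); split=> //=; exact: bruhat_trans tx.
rewrite {1}/a pinvKV ?inE //; last exact: (injon _ _ _ _ Ij).
rewrite /a -ya pinvKV ?inE //; last 2 first.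
- exact: (injon _ _ _ _ Ij').
- by split=> //; case: yj.
have yi : interval S (u', v'_ i) y.
  by split; [case: yj|exact: bruhat_trans w'i].
move/inji; rewrite !inE => e.
suff -> : z' = y by [].
apply: (poset_iso_inj Ii') => //; rewrite -ez; apply: e.
  split; first by have [] := poset_iso_in Ii zi.
  exact/(poset_iso_mono Ii zi wi_).
split; first by have [] := poset_iso_in Ii' yi.
by rewrite /= ewi; apply/(poset_iso_mono Ii' yi w'i_).
Qed.

(** The tops are paired separately because they lie below no coatom. Independence of the index i is
    not built in; it is established inside [match_rel_mono]. *)
Definition match_rel z z' : Prop := (z = v /\ z' = v') \/
  exists2 i, (i < size c)%N & [/\ interval S (u, v_ i) z,
    interval S (u', v'_ i) z' & Th i z = Th' i z'].

(** As [n > 1], an element covered by v cannot be u, so it is listed in c. *)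
Lemma coatom_index a : le u a -> cover a v ->
  exists2 i, (i < size c)%N & v_ i = a.
Proof.
move=> ua ca; have [_ hc] := match_enum M.
have ac : a \in c.
  apply/hc; split=> //; split=> // e; have [_ /= lv] := match_interval M.
  by have [_] := (bruhat_coverP S a v).1 ca; rewrite lv -e /=; lia.
by exists (index a c); rewrite ?index_mem // /coatom nth_index.
Qed.

Lemma match_rel_total z : interval S (u, v) z ->
  exists2 z', interval S (u', v') z' & match_rel z z'.
Proof.
move=> [uz zv]; have [->|/eqP nzv] := eqVneq z v.
  exists v'; last by left.
  by split; [case: (match_interval' M)|exact: bruhat_refl].
have [a za ca] := bruhat_coatom hS zv nzv.
have [i ic ea] := coatom_index (bruhat_trans uz za) ca.
have [q [hq I I']] := match_Theta M ic.
have zi : interval S (u, v_ i) z by split=> //; rewrite ea.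
have [z' z'i e] := poset_iso_surj I' (poset_iso_in I zi).
have ic' : (i < size c')%N by rewrite -(match_size M).
exists z'; last by right; exists i.
exact: (interval_coatom (match_enum' M) ic').
Qed.

(** If z2 is matched through v_i and z1 through v_j, a path of coatoms above z1 carries the matching
    of z1 to index i, where a single pair Theta_i, Theta'_i compares both elements. *)
Lemma match_rel_mono z1 z2 z1' z2' : interval S (u', v') z1' ->
  match_rel z1 z1' -> match_rel z2 z2' -> le z1 z2 -> le z1' z2'.
Proof.
move=> [_ z1v'] h1 [[-> -> //]|[i ic [iz2 iz2' e2]]] z12.
have [_ _ ci] := coatom_enumP (match_enum M) ic.
have z1i : le z1 (v_ i) by apply: bruhat_trans z12 _; case: iz2.
case: h1 => [[ez1 _]|[j jc [jz1 jz1' e1]]].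
  have [_] := (bruhat_coverP S (v_ i) v).1 ci.
  by have := bruhat_length_le z1i; rewrite ez1; lia.
have uz1 : le u z1 by case: jz1.
have uq : uniq c by case: (match_enum M).
pose Q a := forall k, (k < size c)%N -> v_ k = a ->
  interval S (u', v'_ k) z1' /\ Th k z1 = Th' k z1'.
have [_ _ cj] := coatom_enumP (match_enum M) jc.
have Qj : Q (v_ j).
  move=> k kc /eqP; rewrite nth_uniq // => /eqP-> //.
have [|z1i' e1i] := coatoms_connected hS (Q := Q) _ jz1.2 cj z1i ci Qj i ic erefl.
  move=> a b w ca cb zw cwa cwb Qa k kc ek.
  have wa := ((bruhat_coverP S w a).1 cwa).1.
  have [l lc el] := coatom_index (bruhat_trans uz1 (bruhat_trans zw wa)) ca.
  have [h1 h2] := Qa l lc el.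
  by apply: (@Theta_match_step l k w z1 z1') => //; rewrite ?el ?ek.
have [q [hq I I']] := match_Theta M ic.
apply/(poset_iso_mono I' z1i' iz2'); rewrite -e1i -e2.
by apply/(poset_iso_mono I _ iz2).
Qed.

End HalfMatch.

Lemma match_rel_sym u v c psi u' v' c' psi' z z' : size c = size c' ->
  match_rel u v c psi u' v' c' psi' z z' <->
  match_rel u' v' c' psi' u v c psi z' z.
Proof.
move=> e; split=> -[[-> ->]|[i ic [h1 h2 h3]]]; try (by left); right; exists i => //.
  by rewrite -e.
by rewrite e.
Qed.

Lemma tpa_match_isomorphic u v c psi u' v' c' psi' : (1 < n)%N ->
  tpa_match u v c psi u' v' c' psi' -> poset_isomorphic S (u, v) (u', v').
Proof.
move=> n2 M; have M' := tpa_match_sym M; have e := match_size M.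
apply: (poset_isomorphic_rel (match_rel_total n2 M)).
- move=> y /(match_rel_total n2 M')[x px] h; exists x => //.
  by apply/match_rel_sym.
- move=> x x' y y' px px' qy qy' h h'; split; first exact: (match_rel_mono n2 M).
  by apply: (match_rel_mono n2 M') => //; apply/match_rel_sym.
Qed.

Lemma interval_length1 u v z : is_interval S 1 (u, v) -> interval S (u, v) z ->
  z = u \/ z = v.
Proof.
move=> [_ /= luv] [/= uz zv].
case: (bruhat_le_length uz) => [->|luz]; [by left|right].
by apply: (@bruhat_le_eq _ S) => //; lia.
Qed.

(** In length 1 the bottom is excluded from the coatoms, so the triple carries no information and
    the isomorphism is written down directly. *)
Lemma length1_isomorphic u v u' v' : is_interval S 1 (u, v) ->
  is_interval S 1 (u', v') -> poset_isomorphic S (u, v) (u', v').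
Proof.
move=> h h'; pose F z z' := (z = u /\ z' = u') \/ (z = v /\ z' = v').
have nle x y : is_interval S 1 (x, y) -> ~ le y x.
  by move=> [_ /= l] /bruhat_length_le; lia.
have [[uv _] [uv' _]] := (h, h').
have r := @bruhat_refl _ S.
apply: (@poset_isomorphic_rel _ _ _ _ F).
- move=> x /(interval_length1 h)[->|->]; [exists u'|exists v'] => //;
    (by split) || (by left) || by right.
- move=> x /(interval_length1 h')[->|->]; [exists u|exists v] => //;
    (by split) || (by left) || by right.
- move=> x x' y y' _ _ _ _ [[-> ->]|[-> ->]] [[-> ->]|[-> ->]]; split=> // H;
    by [exact: r|case: (nle _ _ h)|case: (nle _ _ h')].
Qed.

End Match.

Theorem theorem3 (W : groupType) (S : set W) (hS : coxeter_system S)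
  (n : nat) (hn : (1 <= n)%N) (D : interval_data S n)
  (u v u' v' : W) (c c' : seq W)
  (huv : is_interval S n (u, v)) (huv' : is_interval S n (u', v'))
  (hc : coatom_enum S (u, v) c) (hc' : coatom_enum S (u', v') c') :
  TPA D u v c = TPA D u' v' c' -> poset_isomorphic S (u, v) (u', v').
Proof.
move=> eTPA; have [n1|n2] := leqP n 1.
  have e1 : n = 1%N by lia.
  by rewrite e1 in huv huv'; exact: length1_isomorphic.
(* The identity tuple provides one triple on the left; equality of the sets then yields psi' with
   the same triple. *)
have : TPA D u v c (T_inv D u c, P_inv D u v c (fun=> idfun),
    A_inv D u v c (fun=> idfun)).
  by exists (fun=> idfun); split=> // i _; exact: poset_iso_id.
rewrite eTPA => -[psi' [hpsi' [eT eP eA]]].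
have es : size c = size c' by have := congr1 size eT; rewrite !size_map.
apply: (@tpa_match_isomorphic _ _ hS n D _ _ c (fun=> idfun) _ _ c' psi') => //.
split=> // i ic; have ic' : (i < size c')%N by rewrite -es.
have n1 : (n.-1 < n)%N by lia.
have len x y d : is_interval S n (x, y) -> coatom_enum S (x, y) d ->
    (i < size d)%N -> is_interval S n.-1 (x, coatom x d i).
  move=> [_ /= lxy] hd id; have [h1 _ /bruhat_coverP[_ h2]] := coatom_enumP hd id.
  by split=> //=; lia.
have [r1 I1] := phi_rep D n1 (len _ _ _ huv hc ic).
have [r2 I2] := phi_rep D n1 (len _ _ _ huv' hc' ic').
(* Equal entries of [T_inv] are equal numbers, and numbering is injective on the representatives. *)
have er : rep_of D n.-1 (u, coatom u c i) = rep_of D n.-1 (u', coatom u' c' i).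
  have := congr1 (fun s => nth 0%N s i) eT.
  rewrite (nth_map u) // (nth_map u') // => /(number_inj n1).
  by apply; rewrite inE.
exists (rep_of D n.-1 (u, coatom u c i)); split.
- exact: (reps_interval n1 r1).
- exact: (poset_iso_comp (poset_iso_id _ _) I1).
- by rewrite er; exact: (poset_iso_comp (hpsi' i ic') I2).
Qed.
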